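(* Let $\hat\alpha\in(-1,1)$, let $\beta^-,\beta^+>0$, and let $\{\phi_n\}_{n\ge 0}$ be the generalized Lobatto polynomials on $[-1,1]$ associated with $\hat\alpha,\beta^-,\beta^+$ (defined in the context). Then $\{\phi_n\}$ is a sequence of piecewise polynomials (polynomial on each of $(-1,\hat\alpha)$ and $(\hat\alpha,1)$) which satisfies: (i) the interface jump conditions $$[\![\phi_n(\hat\alpha)]\!]=0,\qquad [\![\hat\beta\phi_n'(\hat\alpha)]\!]=0,\qquad \forall\, n\ge 0;$$ (ii) the weighted orthogonality condition $$\int_{-1}^1\hat\beta(\xi)\,\phi_m'(\xi)\,\phi_n'(\xi)\,d\xi=\tilde c_n\,\delta_{mn},\qquad \forall\, m,n\ge 1,$$ where $\tilde c_n$ is some nonzero constant.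
   Context: Notation: $\tau^-=(-1,\hat\alpha)$, $\tau^+=(\hat\alpha,1)$; $\hat\beta(\xi)=\beta^-$ on $\tau^-$ and $\hat\beta(\xi)=\beta^+$ on $\tau^+$; $w(\xi)=1/\hat\beta(\xi)$. The jump of a function $v$ at $\hat\alpha$ is $[\![v(\hat\alpha)]\!]=v(\hat\alpha^+)-v(\hat\alpha^-)$ (difference of one-sided limits). Generalized Legendre polynomials: $\{L_n\}_{n\ge0}$ is the unique sequence of monic polynomials, $\deg L_n=n$, with $\int_{-1}^1 w(\xi)L_n(\xi)L_m(\xi)\,d\xi=0$ for $m\neq n$. Generalized Lobatto polynomials: with $D=(1-\hat\alpha)\beta^-+(1+\hat\alpha)\beta^+$, $$\phi_0(\xi)=\begin{cases}\dfrac{(1-\hat\alpha)\beta^-+(\hat\alpha-\xi)\beta^+}{D}&\text{in }\tau^-,\\[2mm]\dfrac{(1-\xi)\beta^-}{D}&\text{in }\tau^+,\end{cases}\qquad \phi_1(\xi)=\begin{cases}\dfrac{(1+\xi)\beta^+}{D}&\text{in }\tau^-,\\[2mm]\dfrac{(\xi-\hat\alpha)\beta^-+(1+\hat\alpha)\beta^+}{D}&\text{in }\tau^+,\end{cases}$$ $$\phi_n(\xi)=\int_{-1}^{\xi}w(t)L_{n-1}(t)\,dt,\qquad n\ge 2.$$ *)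

(* Defs.v *)
From HB Require Import structures.
From mathcomp Require Import all_boot all_order all_algebra.
From mathcomp Require Import all_classical all_reals all_analysis.
Set Implicit Arguments.
Unset Strict Implicit.
Unset Printing Implicit Defensive.
Import Order.TTheory GRing.Theory Num.Theory.
Import numFieldNormedType.Exports.
Local Open Scope classical_set_scope.
Local Open Scope ring_scope.

(* The interface a is assigned to the right-hand piece in [beta_hat] and in
   [lobatto] below.  This is immaterial: {a} is Lebesgue-null, jumps only use
   one-sided limits, and the two branches of [lobatto _ _ _ _ 0] and of
   [lobatto _ _ _ _ 1] agree at a. *)
Definition beta_hat (R : realType) (a bm bp x : R) : R :=
  if x < a then bm else bp.

Definition weight (R : realType) (a bm bp x : R) : R :=
  (beta_hat a bm bp x)^-1.

Definition generalized_legendre (R : realType) (a bm bp : R)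
    (L : nat -> {poly R}) : Prop :=
  (forall n, L n \is monic /\ size (L n) = n.+1) /\
  (forall m n, m <> n ->
    (\int[lebesgue_measure]_(x in `](-1)%R, 1%R[)
       (weight a bm bp x * (L n).[x] * (L m).[x]))%R = 0).

(* Only the restriction to [-1, 1] is meaningful. *)
Definition lobatto (R : realType) (a bm bp : R) (L : nat -> {poly R})
    (n : nat) (x : R) : R :=
  let D := (1 - a) * bm + (1 + a) * bp in
  match n with
  | 0%N => if x < a then ((1 - a) * bm + (a - x) * bp) / D
           else (1 - x) * bm / D
  | 1%N => if x < a then (1 + x) * bp / D
           else ((x - a) * bm + (1 + a) * bp) / D
  | _ => (\int[lebesgue_measure]_(t in `[(-1)%R, x])
            (weight a bm bp t * (L n.-1).[t]))%R
  end.

(* v has one-sided limits at a, and v(a^+) - v(a^-) = j. *)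
Definition is_jump (R : realType) (v : R -> R) (a j : R) : Prop :=
  exists vl vr : R,
    [/\ v x @[x --> a^'-] --> vl, v x @[x --> a^'+] --> vr & vr - vl = j].

Definition piecewise_polynomial (R : realType) (a : R) (v : R -> R) : Prop :=
  exists p q : {poly R},
    (forall x, -1 < x < a -> v x = p.[x]) /\
    (forall x, a < x < 1 -> v x = q.[x]).

(* Main.v *)
(** On each side of a, phi_n is a polynomial, and beta_hat * phi_n' is the same
    polynomial k_n *: L_(n-1) on both sides, with k_n nonzero (k_n = 1 for
    n >= 2, and a harmonic-mean type constant, up to sign, for n = 0, 1, where
    L_0 = 1).  Hence the flux has no jump, and beta_hat * phi_m' * phi_n' is
    k_m * k_n * w * L_(m-1) * L_(n-1) away from a, so that (ii) is the
    orthogonality of the L_n.  All integrals are computed by the fundamental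
    theorem of calculus on both sides of a; the constants are positive because
    a primitive of the square of a nonzero polynomial is strictly increasing. *)

Require Import Defs.
From HB Require Import structures.
From mathcomp Require Import all_boot all_order all_algebra.
From mathcomp Require Import all_classical all_reals all_analysis.
From mathcomp Require Import measurable_realfun ring lra.
Set Implicit Arguments.
Unset Strict Implicit.
Unset Printing Implicit Defensive.
Import Order.TTheory GRing.Theory Num.Theory.
Import numFieldNormedType.Exports.
Local Open Scope classical_set_scope.
Local Open Scope ring_scope.

(** * Primitives and rigidity of polynomials *)

Definition antideriv (F : numFieldType) (p : {poly F}) : {poly F} :=
  \poly_(i < (size p).+1) (p`_i.-1 / i%:R).

Lemma deriv_antideriv (F : numFieldType) (p : {poly F}) :
  (antideriv p)^`() = p.
Proof.
apply/polyP => i; rewrite coef_deriv coef_poly ltnS /=.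
case: ltnP => [_|/leq_sizeP -> //]; last by rewrite mul0rn.
by rewrite -[LHS]mulr_natr divfK// pnatr_eq0.
Qed.

(** Otherwise the nonzero difference, of size N and hence degree N - 1, would have N distinct
    roots. *)
Lemma poly_eq_itv (F : realFieldType) (u v : F) (p q : {poly F}) : u < v ->
  (forall x, u < x < v -> p.[x] = q.[x]) -> p = q.
Proof.
move=> uv pq; apply/eqP; rewrite -subr_eq0; apply/negPn/negP => pq0.
set N := size (p - q).
(* The N points are equally spaced; the fractions (i + 1) / (N + 1) with i < N keep them off both
   ends of the interval. *)
pose z i : F := u + (v - u) * (i.+1%:R / N.+1%:R).
have vu0 : 0 < v - u by rewrite subr_gt0.
suff: (size [seq z i | i <- iota 0 N] < N)%N by rewrite size_map size_iota ltnn.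
apply: max_poly_roots => //; last first.
  rewrite map_inj_uniq ?iota_uniq// => i j /addrI /(mulfI (lt0r_neq0 vu0)).
  have /mulIf inj : N.+1%:R^-1 != 0 :> F by rewrite invr_eq0 pnatr_eq0.
  by move=> /inj /eqP; rewrite eqr_nat eqSS => /eqP.
apply/allP => _ /mapP[i iN ->]; rewrite mem_iota add0n in iN.
rewrite /root hornerD hornerN subr_eq0 pq//.
have i0 : 0 < i.+1%:R / N.+1%:R :> F by rewrite divr_gt0.
have i1 : i.+1%:R / N.+1%:R < 1 :> F by rewrite ltr_pdivrMr// mul1r ltr_nat ltnS.
by rewrite /z ltrDl mulr_gt0//= -ltrBrDl gtr_pMr.
Qed.

Lemma horner_lt_of_deriv_ge0 (R : realType) (P : {poly R}) (u v : R) : u < v ->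
  P^`() != 0 -> (forall x, 0 <= P^`().[x]) -> P.[u] < P.[v].
Proof.
move=> uv P'0 P'ge0.
have mono : {in `[u, v] &, {homo horner P : x y / x <= y}}.
  apply: ger0_derive1_le_cc => [x _|x _|].
  - exact: derivable_horner.
  - by rewrite -derivE.
  - by apply: continuous_subspaceT; exact: continuous_horner.
have uI : u \in `[u, v] by rewrite in_itv/= lexx ltW.
have vI : v \in `[u, v] by rewrite in_itv/= lexx ltW.
rewrite lt_neqAle mono// ?andbT; last exact: ltW.
apply: contra P'0 => /eqP Puv.
suff -> : P = P.[u]%:P by rewrite derivC.
apply: poly_eq_itv uv _ => x /andP[ux xv]; rewrite hornerC.
have xI : x \in `[u, v] by rewrite in_itv/= !ltW.
by apply/eqP; rewrite eq_le {1}Puv !mono// ltW.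
Qed.

(** * Integrals of piecewise polynomials *)

Lemma integral_deriv (R : realType) (u v : R) (P : {poly R}) : u < v ->
  (\int[lebesgue_measure]_(x in `]u, v[) (P^`().[x])%:E)%E
  = (P.[v] - P.[u])%:E.
Proof.
(* The endpoints are added, at no cost to the integral, to apply the fundamental theorem on a closed
   interval. *)
move=> uv; rewrite -(integral_itv_bndoo true false); last first.
  by apply/measurable_EFinP; exact: measurable_poly.
rewrite (@continuous_FTC2 _ _ (horner P))//.
- by apply: continuous_subspaceT; exact: continuous_horner.
- split=> [x _| |]; first exact: derivable_horner.
  + by apply: cvg_at_right_filter; exact: continuous_horner.
  + by apply: cvg_at_left_filter; exact: continuous_horner.
- by move=> x _; rewrite derivE.
Qed.

(* The values of [f] at [u], [a] and [v] are irrelevant. *)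
Lemma Rintegral_piecewise (R : realType) (b c : bool) (u a v : R)
    (f : R -> R) (P Q : {poly R}) : u < a -> a < v ->
  (forall x, u < x < a -> f x = P^`().[x]) ->
  (forall x, a < x < v -> f x = Q^`().[x]) ->
  \int[lebesgue_measure]_(x in [set` Interval (BSide b u) (BSide c v)]) f x
  = P.[a] - P.[u] + (Q.[v] - Q.[a]).
Proof.
move=> ua av fP fQ.
have inE (s t x : R) : x \in `]s, t[%classic -> s < x < t.
  by rewrite inE/= in_itv.
have mL : measurable_fun `]u, a[ f.
  apply: (eq_measurable_fun (horner P^`())); last exact: measurable_poly.
  by move=> x /inE /fP ->.
have mR : measurable_fun `]a, v[ f.
  apply: (eq_measurable_fun (horner Q^`())); last exact: measurable_poly.
  by move=> x /inE /fQ ->.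
have punct : `]u, v[ `\ a = `]u, a[ `|` `]a, v[.
  apply/seteqP; split=> x /=; rewrite !in_itv/=.
    by move=> [/andP[ux xv] /eqP]; rewrite neq_lt ux xv andbT => /orP.
  case=> /andP[h1 h2]; split.
  - by rewrite h1 (lt_trans h2).
  - by move=> xa; rewrite xa ltxx in h2.
  - by rewrite h2 (lt_trans ua).
  - by move=> xa; rewrite xa ltxx in h1.
have mU : measurable_fun (`]u, v[ `\ a) f by rewrite punct; apply/measurable_funU.
(* Measurability must survive putting [a] back before the null points [u], [v] and [a] can be
   discarded from the integral. *)
have mf : measurable_fun `]u, v[ f.
  rewrite -(@setD1K _ a `]u, v[) /=; last by rewrite in_itv/= ua.
  apply/measurable_funU => //; first exact: measurableD.
  by split => //; exact: measurable_fun_set1.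
rewrite /Rintegral integral_itv_bndoo; last exact/measurable_EFinP.
rewrite -(integral_setD1 (r := a)); [|exact: measurableD|exact/measurable_EFinP].
rewrite punct integral_setU//; last 2 first.
- by rewrite -punct; exact/measurable_EFinP.
- apply/disj_setPS => x [/=]; rewrite !in_itv/= => /andP[_ xa] /andP[ax _].
  by have := lt_trans xa ax; rewrite ltxx.
have -> : (\int[lebesgue_measure]_(x in `]u, a[) (f x)%:E = (P.[a] - P.[u])%:E)%E.
  by rewrite -integral_deriv//; apply: eq_integral => x /inE /fP ->.
have -> : (\int[lebesgue_measure]_(x in `]a, v[) (f x)%:E = (Q.[v] - Q.[a])%:E)%E.
  by rewrite -integral_deriv//; apply: eq_integral => x /inE /fQ ->.
by [].
Qed.

(** * Polynomial pieces of the Lobatto functions *)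

Lemma weight_left (R : realType) (a bm bp x : R) : x < a ->
  weight a bm bp x = bm^-1.
Proof. by rewrite /weight /beta_hat => ->. Qed.

Lemma weight_right (R : realType) (a bm bp x : R) : a < x ->
  weight a bm bp x = bp^-1.
Proof. by move=> ax; rewrite /weight /beta_hat ltNge ltW. Qed.

(* The factor k in [beta_hat * phi_n' = k *: L_(n-1)]; with the convention
   [0.-1 = 0] this covers n = 0 as well. *)
Definition lobatto_flux (R : realType) (a bm bp : R) (n : nat) : R :=
  let K := bm * bp / ((1 - a) * bm + (1 + a) * bp) in
  match n with 0%N => - K | 1%N => K | _ => 1 end.

Lemma lobatto_flux_neq0 (R : realType) (a bm bp : R) (n : nat) :
  -1 < a < 1 -> 0 < bm -> 0 < bp -> lobatto_flux a bm bp n != 0.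
Proof.
move=> /andP[a1 a2] bm0 bp0.
have K0 : 0 < bm * bp / ((1 - a) * bm + (1 + a) * bp).
  rewrite divr_gt0 ?mulr_gt0//.
  by rewrite addr_gt0// mulr_gt0//; lra.
by case: n => [|[|n]] /=; rewrite ?oppr_eq0 ?lt0r_neq0.
Qed.

Lemma lobatto_pieces (R : realType) (a bm bp : R) (L : nat -> {poly R})
    (n : nat) : -1 < a < 1 -> 0 < bm -> 0 < bp -> L 0%N = 1 ->
  exists p q : {poly R},
    [/\ forall x, -1 < x < a -> lobatto a bm bp L n x = p.[x],
        forall x, a < x < 1 -> lobatto a bm bp L n x = q.[x],
        p.[a] = q.[a],
        p^`() = (lobatto_flux a bm bp n / bm) *: L n.-1 &
        q^`() = (lobatto_flux a bm bp n / bp) *: L n.-1].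
Proof.
move=> /andP[a1 a2] bm0 bp0 L0.
have bm1 := lt0r_neq0 bm0; have bp1 := lt0r_neq0 bp0.
have D0 : (1 - a) * bm + (1 + a) * bp != 0.
  by apply: lt0r_neq0; rewrite addr_gt0// mulr_gt0//; lra.
have right_ge x : a < x -> x < a = false by move=> /ltW; rewrite leNgt => /negbTE.
have derivlin (c d : R) : (c *: 'X + d%:P)^`() = c *: 1.
  by rewrite derivD derivZ derivX derivC addr0.
case: n => [|[|n]] /=.
- set D := (1 - a) * bm + (1 + a) * bp in D0 *.
  (* For n = 0 and n = 1 each branch is affine; its slope is the flux constant divided by [bm] or
     [bp]. *)
  exists (- (bp / D) *: 'X + (((1 - a) * bm + a * bp) / D)%:P).
  exists (- (bm / D) *: 'X + (bm / D)%:P).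
  split.
  + by move=> x /andP[_ xa]; rewrite xa !hornerE; field.
  + by move=> x /andP[ax _]; rewrite right_ge// !hornerE; field.
  + by rewrite !hornerE; field.
  + by rewrite derivlin L0; congr (_ *: _); field; rewrite ?D0 ?bm1 ?bp1.
  + by rewrite derivlin L0; congr (_ *: _); field; rewrite ?D0 ?bm1 ?bp1.
- set D := (1 - a) * bm + (1 + a) * bp in D0 *.
  exists ((bp / D) *: 'X + (bp / D)%:P).
  exists ((bm / D) *: 'X + (((1 + a) * bp - a * bm) / D)%:P).
  split.
  + by move=> x /andP[_ xa]; rewrite xa !hornerE; field.
  + by move=> x /andP[ax _]; rewrite right_ge// !hornerE; field.
  + by rewrite !hornerE; field.
  + by rewrite derivlin L0; congr (_ *: _); field; rewrite ?D0 ?bm1 ?bp1.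
  + by rewrite derivlin L0; congr (_ *: _); field; rewrite ?D0 ?bm1 ?bp1.
- have [P dP] : exists P, P^`() = L n.+1.
    by exists (antideriv (L n.+1)); exact: deriv_antideriv.
  have P' c x : (c *: P)^`().[x] = c * (L n.+1).[x].
    by rewrite derivZ hornerZ dP.
  exists (bm^-1 *: (P - P.[-1]%:P)).
  (* The added constant is the integral over the whole left piece, so the two polynomials match at
     [a]. *)
  exists (bp^-1 *: (P - P.[a]%:P) + (bm^-1 * (P.[a] - P.[-1]))%:P).
  split.
  + move=> x /andP[x1 xa].
    (* The weight is constant left of [a], so any interior cut works; the midpoint of [-1, x] is
       taken, with the same primitive on both halves. *)
    rewrite (@Rintegral_piecewise _ true false _ ((x - 1) / 2) _ _
      (bm^-1 *: P) (bm^-1 *: P)).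
    * by rewrite !(hornerZ, hornerD, hornerN, hornerC); ring.
    * by lra.
    * by lra.
    * by move=> y /andP[y1 y2]; rewrite P' weight_left//; lra.
    * by move=> y /andP[y1 y2]; rewrite P' weight_left//; lra.
  + move=> x /andP[ax x1].
    rewrite (@Rintegral_piecewise _ true false _ a _ _
      (bm^-1 *: P) (bp^-1 *: P))//.
    * by rewrite !(hornerZ, hornerD, hornerN, hornerC); ring.
    * by move=> y /andP[_ ya]; rewrite P' weight_left.
    * by move=> y /andP[ay _]; rewrite P' weight_right.
  + by rewrite !(hornerZ, hornerD, hornerN, hornerC); ring.
  + by rewrite derivZ derivB derivC subr0 dP div1r.
  + by rewrite derivD derivZ derivB !derivC subr0 addr0 dP div1r.
Qed.

(** * Derivatives and jumps read off the pieces *)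

Lemma derive1_horner_itv (R : realType) (f : R -> R) (p : {poly R})
    (u v x : R) : (forall y, u < y < v -> f y = p.[y]) -> u < x < v ->
  derive1 f x = p^`().[x].
Proof.
move=> fp uxv; rewrite derivE !derive1E; apply: near_eq_derive.
have /near_in_itvoo : x \in `]u, v[ by rewrite in_itv.
by apply: filterS => y; rewrite in_itv/= => /fp.
Qed.

(** By continuity the one-sided limits are [p.[a]] and [q.[a]]; the value [f a] never enters, so
    this applies to the flux as well as to phi_n. *)
Lemma is_jump0_pieces (R : realType) (f : R -> R) (p q : {poly R})
    (u a v : R) : u < a -> a < v ->
  (forall x, u < x < a -> f x = p.[x]) ->
  (forall x, a < x < v -> f x = q.[x]) ->
  p.[a] = q.[a] -> is_jump f a 0.
Proof.
move=> ua av fp fq pq; exists p.[a], q.[a]; split; last by rewrite pq subrr.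
- have : p.[x] @[x --> a^'-] --> p.[a].
    by apply: cvg_at_left_filter; exact: continuous_horner.
  apply: cvg_trans; apply: near_eq_cvg; near=> x.
  by symmetry; apply: fp; apply/andP; split; near: x;
    [exact: nbhs_left_gt|exact: nbhs_left_lt].
- have : q.[x] @[x --> a^'+] --> q.[a].
    by apply: cvg_at_right_filter; exact: continuous_horner.
  apply: cvg_trans; apply: near_eq_cvg; near=> x.
  by symmetry; apply: fq; apply/andP; split; near: x;
    [exact: nbhs_right_gt|exact: nbhs_right_lt].
Unshelve. all: by end_near. Qed.

(** * Weighted integrals and orthogonality *)

Lemma Rintegral_weight_deriv (R : realType) (a bm bp : R) (P : {poly R}) :
  -1 < a < 1 ->
  \int[lebesgue_measure]_(x in `](-1)%R, 1%R[) (weight a bm bp x * P^`().[x])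
  = bm^-1 * (P.[a] - P.[-1]) + bp^-1 * (P.[1] - P.[a]).
Proof.
move=> /andP[a1 a2].
rewrite (@Rintegral_piecewise _ false true _ a _ _ (bm^-1 *: P) (bp^-1 *: P))//.
- by rewrite !hornerZ; ring.
- by move=> x /andP[_ xa]; rewrite derivZ hornerZ weight_left.
- by move=> x /andP[ax _]; rewrite derivZ hornerZ weight_right.
Qed.

Lemma Rintegral_weight_gt0 (R : realType) (a bm bp : R) (p : {poly R}) :
  -1 < a < 1 -> 0 < bm -> 0 < bp -> p != 0 ->
  0 < \int[lebesgue_measure]_(x in `](-1)%R, 1%R[)
        (weight a bm bp x * p.[x] * p.[x]).
Proof.
move=> /[dup] /andP[a1 a2] ha bm0 bp0 p0.
pose P := antideriv (p * p); have dP : P^`() = p * p := deriv_antideriv _.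
under eq_Rintegral do rewrite -mulrA -hornerM -dP.
have incr u v : u < v -> P.[u] < P.[v].
  move=> uv; apply: horner_lt_of_deriv_ge0 => //; rewrite dP ?mulf_neq0//.
  by move=> x; rewrite hornerM -expr2 sqr_ge0.
by rewrite Rintegral_weight_deriv// addr_gt0// mulr_gt0 ?invr_gt0// subr_gt0 incr.
Qed.

(** The point [a] is excluded because phi_n may have a kink there. *)
Lemma beta_hat_derive1_lobatto (R : realType) (a bm bp : R) (L : nat -> {poly R})
    (n : nat) : -1 < a < 1 -> 0 < bm -> 0 < bp -> L 0%N = 1 ->
  forall x, -1 < x < 1 -> x != a ->
  beta_hat a bm bp x * derive1 (lobatto a bm bp L n) x
  = lobatto_flux a bm bp n * (L n.-1).[x].
Proof.
move=> ha bm0 bp0 L0 x /andP[x1 x2].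
have [p [q [fp fq _ dp dq]]] := lobatto_pieces n ha bm0 bp0 L0.
rewrite neq_lt /beta_hat => /orP[xa|ax].
- rewrite xa (derive1_horner_itv fp) ?x1// dp hornerZ mulrA.
  by rewrite [bm * _]mulrC divfK// lt0r_neq0.
- rewrite ltNge (ltW ax)/= (derive1_horner_itv fq) ?ax// dq hornerZ mulrA.
  by rewrite [bp * _]mulrC divfK// lt0r_neq0.
Qed.

Lemma Rintegral_lobatto_deriv (R : realType) (a bm bp : R)
    (L : nat -> {poly R}) (m n : nat) :
  -1 < a < 1 -> 0 < bm -> 0 < bp -> L 0%N = 1 ->
  \int[lebesgue_measure]_(x in `](-1)%R, 1%R[)
    (beta_hat a bm bp x * derive1 (lobatto a bm bp L m) x
       * derive1 (lobatto a bm bp L n) x)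
  = lobatto_flux a bm bp m * lobatto_flux a bm bp n *
    \int[lebesgue_measure]_(x in `](-1)%R, 1%R[)
      (weight a bm bp x * (L m.-1).[x] * (L n.-1).[x]).
Proof.
move=> /[dup] /andP[a1 a2] ha bm0 bp0 L0.
set km := lobatto_flux a bm bp m; set kn := lobatto_flux a bm bp n.
have [P dP] : exists P, P^`() = L m.-1 * L n.-1.
  by exists (antideriv (L m.-1 * L n.-1)); exact: deriv_antideriv.
under [in RHS]eq_Rintegral do rewrite -mulrA -hornerM -dP.
rewrite Rintegral_weight_deriv//.
(* One factor absorbs [beta_hat] and becomes [km] times a Legendre polynomial; the other is solved
   for phi_n', which brings in the weight. *)
have integrandE x : -1 < x < 1 -> x != a ->
    beta_hat a bm bp x * derive1 (lobatto a bm bp L m) x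
      * derive1 (lobatto a bm bp L n) x
    = weight a bm bp x * (km * kn * P^`().[x]).
  move=> xI xa; have b0 : beta_hat a bm bp x != 0.
    by rewrite /beta_hat; case: ifP => _; exact: lt0r_neq0.
  rewrite beta_hat_derive1_lobatto// -/km dP hornerM.
  have -> : derive1 (lobatto a bm bp L n) x
      = weight a bm bp x * (kn * (L n.-1).[x]).
    by rewrite /kn -beta_hat_derive1_lobatto// mulKf.
  by ring.
rewrite (@Rintegral_piecewise _ false true _ a _ _
  ((km * kn / bm) *: P) ((km * kn / bp) *: P))//.
- by rewrite !hornerZ; ring.
- move=> x /andP[x1 xa].
  rewrite integrandE ?x1 ?lt_eqF ?(lt_trans xa a2)//.
  by rewrite weight_left// derivZ hornerZ; ring.
- move=> x /andP[ax x1].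
  rewrite integrandE ?x1 ?gt_eqF ?(lt_trans a1 ax)//.
  by rewrite weight_right// derivZ hornerZ; ring.
Qed.

Theorem theorem3p1 (R : realType) (a bm bp : R) (L : nat -> {poly R})
    (ha : -1 < a < 1) (hbm : 0 < bm) (hbp : 0 < bp)
    (hL : generalized_legendre a bm bp L) :
  [/\ forall n : nat, piecewise_polynomial a (lobatto a bm bp L n),
      forall n : nat,
        is_jump (lobatto a bm bp L n) a 0 /\
        is_jump (fun x => beta_hat a bm bp x * derive1 (lobatto a bm bp L n) x) a 0
    & exists c : nat -> R,
        (forall n : nat, (1 <= n)%N -> c n != 0) /\
        (forall m n : nat, (1 <= m)%N -> (1 <= n)%N ->
          (\int[lebesgue_measure]_(x in `](-1)%R, 1%R[)
             (beta_hat a bm bp x * derive1 (lobatto a bm bp L m) x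
                * derive1 (lobatto a bm bp L n) x))%R
          = c n * (m == n)%:R)].
Proof.
(* A monic polynomial of size 1 is the constant 1. *)
have L0 : L 0%N = 1.
  have [/monicP + sL] := hL.1 0%N.
  have Lc : L 0%N = ((L 0%N)`_0)%:P by apply: size1_polyC; rewrite sL.
  by rewrite Lc lead_coefC => ->.
have /andP[a1 a2] := ha.
split=> [n|n|].
- have [p [q [fp fq _ _ _]]] := lobatto_pieces n ha hbm hbp L0.
  by exists p, q.
- have [p [q [fp fq pq _ _]]] := lobatto_pieces n ha hbm hbp L0.
  split; first exact: is_jump0_pieces fp fq pq.
  (* The flux is the same polynomial on both sides, so its two limits agree trivially. *)
  set M := lobatto_flux a bm bp n *: L n.-1.
  apply: (@is_jump0_pieces _ _ M M (-1) a 1) => // x /andP[h1 h2].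
  + by rewrite beta_hat_derive1_lobatto ?hornerZ ?lt_eqF// h1 (lt_trans h2 a2).
  + by rewrite beta_hat_derive1_lobatto ?hornerZ ?gt_eqF// h2 (lt_trans a1 h1).
(* The constant is the diagonal case of [Rintegral_lobatto_deriv]. *)
- exists (fun n => lobatto_flux a bm bp n ^+ 2 *
    \int[lebesgue_measure]_(x in `](-1)%R, 1%R[)
      (weight a bm bp x * (L n.-1).[x] * (L n.-1).[x])).
  split=> [n _|m n m1 n1].
    rewrite mulf_neq0 ?expf_neq0 ?lobatto_flux_neq0// lt0r_neq0//.
    by rewrite Rintegral_weight_gt0// monic_neq0//; exact: (hL.1 _).1.
  rewrite Rintegral_lobatto_deriv//; have [->|mn] := eqVneq m n.
    by rewrite mulr1 expr2.
  rewrite mulr0 hL.2 ?mulr0//.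
  (* Distinct indices have distinct predecessors only because both are at least 1; 0 and 1 share the
     predecessor 0. *)
  by move=> nm; move: mn; rewrite -(prednK m1) -(prednK n1) nm eqxx.
Qed.
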